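(* Let $q$ be an odd prime and let $\mathcal{D}_\emptyset$ be the arrangement \[ \mathcal{D}_\emptyset=\{(0,1,a)^\perp\mid a\in\mathbb{F}_q\}\cup\{(1,a,a^2)^\perp\mid a\in\mathbb{F}_q\} \] in $\mathbb{F}_q^3$. Then the incidence of $\mathcal{D}_\emptyset$ is isomorphic to the incidence of the real arrangement $\mathcal{A}(2q,1)$ in $\mathbb{R}^3$.
   Context: $(a,b,c)^\perp$ denotes the kernel of the $1\times 3$ matrix $(a\ b\ c)$, i.e. the hyperplane with normal vector $(a,b,c)$. For $n\in\mathbb{N}$ put $c(m):=\cos\frac{2\pi m}{2n}$ and $s(m):=\sin\frac{2\pi m}{2n}$, and for $m=0,\ldots,n-1$ let \[ \alpha_m:=\big(s(2m)c(2m+2)-c(2m)s(2m+2),\ s(2m+2)-s(2m),\ c(2m)-c(2m+2)\big), \] \[ \alpha'_m:=\big(0,\ s(m),\ -c(m)\big). \] Then $\mathcal{A}(2n,1):=\{\alpha_m^\perp,{\alpha'_m}^\perp\mid m=0,\ldots,n-1\}$, an arrangement of $2n$ hyperplanes in $\mathbb{R}^3$. Two arrangements in three-dimensional vector spaces (possibly over different fields) have isomorphic incidences if there is a bijection between their sets of hyperplanes which preserves the incidence structure, i.e. such that the normal vectors of three hyperplanes are linearly dependent if and only if the normal vectors of their images are linearly dependent (equivalently, it induces an isomorphism of intersection lattices). *)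

(* Defs.v *)
From mathcomp Require Import all_boot all_order all_algebra.
From mathcomp Require Import all_classical all_reals all_analysis.

Set Implicit Arguments.
Unset Strict Implicit.
Unset Printing Implicit Defensive.

Import Order.TTheory GRing.Theory Num.Theory.

Local Open Scope classical_set_scope.
Local Open Scope ring_scope.

Definition row3 (K : fieldType) (a b c : K) : 'rV[K]_3 :=
  \row_(j < 3) [:: a; b; c]`_j.

(* The kernel of the 1 x 3 matrix v, acting on column vectors. *)
Definition perp (K : fieldType) (v : 'rV[K]_3) : {vspace 'cV[K]_3} :=
  lker (linfun (mulmx v : 'cV[K]_3 -> 'M[K]_1)).

Definition is_normal (K : fieldType) (H : {vspace 'cV[K]_3}) (v : 'rV[K]_3) :=
  v != 0 /\ H = perp v.

(* A normal vector is unique up to a nonzero scalar, so it does not matter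
   which normals are chosen. *)
Definition dependent_normals (K : fieldType) (H1 H2 H3 : {vspace 'cV[K]_3}) :=
  exists v1 v2 v3 : 'rV[K]_3,
    [/\ is_normal H1 v1, is_normal H2 v2, is_normal H3 v3
      & ~~ free [:: v1; v2; v3]].

Definition isomorphic_incidences (K L : fieldType)
    (A : set {vspace 'cV[K]_3}) (B : set {vspace 'cV[L]_3}) :=
  exists f : {vspace 'cV[K]_3} -> {vspace 'cV[L]_3},
    set_bij A B f /\
    (forall H1 H2 H3, A H1 -> A H2 -> A H3 ->
       (dependent_normals H1 H2 H3 <->
        dependent_normals (f H1) (f H2) (f H3))).

Section RealArrangement.
Variables (R : realType) (n : nat).

Definition c_ (m : nat) : R := cos (2 * pi * m%:R / (2 * n%:R)).
Definition s_ (m : nat) : R := sin (2 * pi * m%:R / (2 * n%:R)).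

Definition alpha (m : nat) : 'rV[R]_3 :=
  row3 (s_ (2 * m) * c_ (2 * m + 2) - c_ (2 * m) * s_ (2 * m + 2))
       (s_ (2 * m + 2) - s_ (2 * m))
       (c_ (2 * m) - c_ (2 * m + 2)).

Definition alpha' (m : nat) : 'rV[R]_3 := row3 0 (s_ m) (- c_ m).

(* The arrangement A(2n,1); `I_n is the set of natural numbers m < n. *)
Definition arrA : set {vspace 'cV[R]_3} :=
  [set perp (alpha m) | m in `I_n] `|` [set perp (alpha' m) | m in `I_n].

End RealArrangement.

Arguments arrA : clear implicits.

(* 'F_q is the field with q elements when q is prime. *)
Definition Dempty (q : nat) : set {vspace 'cV['F_q]_3} :=
  [set perp (row3 0 1 a) | a in [set: 'F_q]] `|`
  [set perp (row3 1 a (a ^+ 2)) | a in [set: 'F_q]].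

Arguments Dempty : clear implicits.

(* Main.v *)
Require Import Defs.
From mathcomp Require Import all_boot all_order all_algebra.
From mathcomp Require Import all_classical all_reals all_analysis.
From mathcomp Require Import ring.

(** Write theta = pi / q.  The projective line over the reals carries the conic
    x |-> (1, cos 2x, sin 2x), just as the projective line over 'F_q carries the
    conic a |-> (1, a, a^2).  Up to a nonzero factor and a fixed rescaling of the
    first coordinate, the normal [alpha m] of the m-th side of the regular q-gon
    is the point of the real conic with parameter w_m = (m + 1/2) theta, and the
    mirror normals [alpha' m] lie on the line [x_0 = 0], as the normals
    (0, 1, c) do over 'F_q.

    Determinants of such triples factor in the same way on both sides.  For
    three conic points the Vandermonde product (a - b)(b - c)(c - a) corresponds
    to the product of the sin (w_a - w_b); for two conic points and a point of
    the line, (a - b)(a + b - c) corresponds to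
    sin (w_a - w_b) sin (w_a + w_b - m theta); for two points of the line and a
    conic point, b - a corresponds to the sine of a difference of angles; three
    points of the line are always dependent.  All angles that occur are integer
    multiples k theta, and sin (k theta) = 0 exactly when q divides k, that is
    when k = 0 in 'F_q ([sin_subr_eq0]).  Since w_a + w_b = (a + b + 1) theta,
    sending (1, a, a^2) to the side [alpha a] and (0, 1, c) to the mirror
    [alpha' (c + 1)] makes the two determinants vanish simultaneously.

    It remains that an indexing under which determinants of normals vanish
    simultaneously is an isomorphism of incidences
    ([isomorphic_incidences_det3]). *)

Set Implicit Arguments.
Unset Strict Implicit.
Unset Printing Implicit Defensive.

Import Order.TTheory GRing.Theory Num.Theory.

Local Open Scope classical_set_scope.
Local Open Scope ring_scope.

(** * Determinants of triples of normals *)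

Lemma row3_eta (K : fieldType) (x : 'rV[K]_3) :
  x = row3 (x 0 0) (x 0 1) (x 0 2%:R).
Proof.
apply/rowP => j; rewrite mxE.
by case: j => [[|[|[|]]] //= h]; congr (x _ _); apply/val_inj.
Qed.

Lemma row3Z (K : fieldType) (k a b c : K) :
  k *: row3 a b c = row3 (k * a) (k * b) (k * c).
Proof. by apply/rowP => j; rewrite !mxE; case: j => [[|[|[|]]]]. Qed.

Definition det3 (K : fieldType) (u v w : 'rV[K]_3) : K :=
  \det (\matrix_(i < 3) [:: u; v; w]`_i).

Lemma det3_row3 (K : fieldType) (a b c d e f g h i : K) :
  det3 (row3 a b c) (row3 d e f) (row3 g h i) =
  a * (e * i - f * h) - b * (d * i - f * g) + c * (d * h - e * g).
Proof.
rewrite /det3 (expand_det_row _ 0) !big_ord_recl big_ord0 /cofactor.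
rewrite !(expand_det_row _ 0) !big_ord_recl !big_ord0 /cofactor !det_mx11.
rewrite !mxE /= ?mxE /= ?expr0 ?expr1 /bump /=.
by ring.
Qed.

Lemma det3_swap12 (K : fieldType) (u v w : 'rV[K]_3) :
  det3 v u w = - det3 u v w.
Proof.
by rewrite (row3_eta u) (row3_eta v) (row3_eta w) !det3_row3; ring.
Qed.

Lemma det3_swap23 (K : fieldType) (u v w : 'rV[K]_3) :
  det3 u w v = - det3 u v w.
Proof.
by rewrite (row3_eta u) (row3_eta v) (row3_eta w) !det3_row3; ring.
Qed.

Lemma det3Z (K : fieldType) (a b c : K) (u v w : 'rV[K]_3) :
  det3 (a *: u) (b *: v) (c *: w) = a * b * c * det3 u v w.
Proof.
by rewrite (row3_eta u) (row3_eta v) (row3_eta w) !row3Z !det3_row3; ring.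
Qed.

Lemma det3_eq0_swap12 (K : fieldType) (u v w : 'rV[K]_3) :
  (det3 v u w == 0) = (det3 u v w == 0).
Proof. by rewrite det3_swap12 oppr_eq0. Qed.

Lemma det3_eq0_swap23 (K : fieldType) (u v w : 'rV[K]_3) :
  (det3 u w v == 0) = (det3 u v w == 0).
Proof. by rewrite det3_swap23 oppr_eq0. Qed.

Lemma free_det3 (K : fieldType) (u v w : 'rV[K]_3) :
  free [:: u; v; w] = (det3 u v w != 0).
Proof.
rewrite /det3; set A := \matrix_i _.
have combE (k : 'rV[K]_3) : k *m A = \sum_(i < 3) k 0 i *: [:: u; v; w]`_i.
  by rewrite mulmx_sum_row; apply: eq_bigr => i _; rewrite rowK.
rewrite -unitfE -unitmxE -row_free_unit.
apply/idP/idP => [/(@freeP _ _ 3 [tuple u; v; w]) fr | frA].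
  apply: inj_row_free => k; rewrite combE => k0.
  by apply/rowP => i; rewrite mxE (fr (k 0)).
apply/(@freeP _ _ 3 [tuple u; v; w]) => k k0 i.
have /(row_free_inj frA)/rowP/(_ i) : (\row_j k j) *m A = 0 *m A.
  by rewrite mul0mx combE -[RHS]k0; apply: eq_bigr => j _; rewrite mxE.
by rewrite !mxE.
Qed.

(** * Incidences read off from determinants *)

Lemma mem_perp (K : fieldType) (v : 'rV[K]_3) (x : 'cV[K]_3) :
  (x \in perp v) = (v *m x == 0).
Proof. by rewrite memv_ker lfunE. Qed.

(** The columns of [cokermx u] lie in the kernel of [u], so a row vector that
    vanishes on this kernel is annihilated by [cokermx u]; this characterises
    the multiples of [u]. *)
Lemma perp_eqP (K : fieldType) (u v : 'rV[K]_3) :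
  u != 0 -> v != 0 ->
  perp u = perp v <-> exists2 a, a != 0 & v = a *: u.
Proof.
move=> u0 v0; split=> [uv | [a a0 ->]]; last first.
  apply/vspaceP => x; rewrite !mem_perp -scalemxAl scaler_eq0.
  by rewrite (negPf a0).
suff /sub_rVP[a va] : (v <= u)%MS.
  by exists a => //; apply: contra_neq v0 => a0; rewrite va a0 scale0r.
have col_coker j : v *m col j (cokermx u) = 0.
  by apply/eqP; rewrite -mem_perp -uv mem_perp colE mulmxA mulmx_coker mul0mx.
rewrite submxE; apply/eqP/matrixP => i j.
move/matrixP/(_ i 0): (col_coker j).
by rewrite colE mulmxA -colE !mxE.
Qed.

(** A hyperplane determines its normal up to a nonzero scalar, and any other choice
    of the three normals multiplies the determinant by the product of such
    scalars. *)
Lemma dependent_perp (K : fieldType) (u v w : 'rV[K]_3) :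
  u != 0 -> v != 0 -> w != 0 ->
  dependent_normals (perp u) (perp v) (perp w) <-> det3 u v w = 0.
Proof.
move=> u0 v0 w0; split; last first.
  by move=> d0; exists u, v, w; split; rewrite // free_det3 d0 eqxx.
move=> [u' [v' [w' [[u'0 uu'] [v'0 vv'] [w'0 ww']]]]].
have [a a0 ->] := iffLR (perp_eqP u0 u'0) uu'.
have [b b0 ->] := iffLR (perp_eqP v0 v'0) vv'.
have [c c0 ->] := iffLR (perp_eqP w0 w'0) ww'.
rewrite free_det3 det3Z negbK !mulf_eq0 (negPf a0) (negPf b0) (negPf c0).
by move/eqP.
Qed.

Lemma det3_eq_perp (K : fieldType) (u v w : 'rV[K]_3) :
  u != 0 -> v != 0 -> perp u = perp v -> det3 u v w = 0.
Proof.
move=> u0 v0 /(perp_eqP u0 v0)[a _ ->].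
have := det3Z 1 a 1 u u w; rewrite !scale1r => ->.
rewrite (row3_eta u) (row3_eta w) det3_row3; ring.
Qed.

(** If every two distinct indices are separated by a nonzero determinant on one
    side, the vanishing condition carries this to the other side.  Separation
    makes the normals nonzero, because there is more than one index, and the
    hyperplanes pairwise distinct, because proportional normals have zero
    determinant with any third vector.  Thus the correspondence of indices is a
    well-defined bijection of hyperplanes. *)
Lemma isomorphic_incidences_det3 (K L : fieldType) (T : Type)
    (N : T -> 'rV[K]_3) (M : T -> 'rV[L]_3) :
  (forall i, exists j : T, i <> j) ->
  (forall i j, i <> j -> exists k, det3 (N i) (N j) (N k) != 0) ->
  (forall i j k,
    (det3 (N i) (N j) (N k) == 0) = (det3 (M i) (M j) (M k) == 0)) ->
  isomorphic_incidences (range (fun i => perp (N i)))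
    (range (fun i => perp (M i))).
Proof.
move=> T2 sepN detNM.
have sepM i j : i <> j -> exists k, det3 (M i) (M j) (M k) != 0.
  by move=> /sepN[k]; rewrite detNM; exists k.
have nz (F : fieldType) (Q : T -> 'rV[F]_3) :
    (forall i j, i <> j -> exists k, det3 (Q i) (Q j) (Q k) != 0) ->
    forall i, Q i != 0.
  move=> sepQ i; have [j /sepQ[k]] := T2 i.
  apply: contra_neq => ->; have := det3Z 0 1 1 0 (Q j) (Q k).
  by rewrite !scale1r scale0r !mul0r.
have perp_inj (F : fieldType) (Q : T -> 'rV[F]_3) :
    (forall i j, i <> j -> exists k, det3 (Q i) (Q j) (Q k) != 0) ->
    injective (fun i => perp (Q i)).
  move=> sepQ i j /= Qij; apply: contrapT => /sepQ[k].
  by rewrite (det3_eq_perp _ (nz _ _ sepQ i) (nz _ _ sepQ j) Qij) eqxx.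
(* The default value is only reached outside the arrangement. *)
pose f H := xget (perp (0 : 'rV[L]_3))
  [set H' | exists2 i, perp (N i) = H & H' = perp (M i)].
have fE i : f (perp (N i)) = perp (M i).
  apply: xget_subset1 => [|H1 H2 [j1 ji1 ->] [j2 ji2 ->]]; first by exists i.
  by rewrite (perp_inj _ _ sepN j1 i ji1) (perp_inj _ _ sepN j2 i ji2).
exists f; split.
  split.
  - by move=> _ [i _ <-] /=; rewrite fE; exists i.
  - move=> _ _ /set_mem[i _ <-] /set_mem[j _ <-] /=.
    by rewrite !fE => /(perp_inj _ _ sepM i j) ->.
  - by move=> _ [i _ <-] /=; exists (perp (N i)); [exists i | rewrite fE].
move=> _ _ _ [i _ <-] [j _ <-] [k _ <-] /=.
rewrite !fE !dependent_perp ?(nz _ _ sepN) ?(nz _ _ sepM) //.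
by split=> /eqP d0; apply/eqP; move: d0; rewrite detNM.
Qed.

(** * Factorisation of the determinants *)

Lemma det3_col0 (K : fieldType) (a b c a' b' c' : K) :
  det3 (row3 0 a a') (row3 0 b b') (row3 0 c c') = 0.
Proof. by rewrite det3_row3; ring. Qed.

Lemma det3_conic (K : fieldType) (a b c : K) :
  det3 (row3 1 a (a ^+ 2)) (row3 1 b (b ^+ 2)) (row3 1 c (c ^+ 2)) =
  (a - b) * (b - c) * (c - a).
Proof. by rewrite det3_row3; ring. Qed.

Lemma det3_line_conic (K : fieldType) (a b c : K) :
  det3 (row3 0 1 c) (row3 1 a (a ^+ 2)) (row3 1 b (b ^+ 2)) =
  (a - b) * (a + b - c).
Proof. by rewrite det3_row3; ring. Qed.

Lemma det3_line2 (K : fieldType) (a b c : K) :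
  det3 (row3 0 1 a) (row3 0 1 b) (row3 1 c (c ^+ 2)) = b - a.
Proof. by rewrite det3_row3; ring. Qed.

Lemma mulr_cos2Dsin2 (R : realType) (k u : R) :
  k = k * (cos u ^+ 2 + sin u ^+ 2).
Proof. by rewrite cos2Dsin2 mulr1. Qed.

(** Writing [k] as [k * (cos x ^+ 2 + sin x ^+ 2)] makes every row a binary
    quadratic form in [cos x] and [sin x]; the identity is then the homogeneous
    Vandermonde identity, [sin (x - y)] being the 2 x 2 determinant of two points
    of the projective line. *)
Lemma det3_tangents (R : realType) (k x y z : R) :
  det3 (row3 k (cos (x *+ 2)) (sin (x *+ 2)))
       (row3 k (cos (y *+ 2)) (sin (y *+ 2)))
       (row3 k (cos (z *+ 2)) (sin (z *+ 2))) =
  4 * k * sin (x - y) * sin (y - z) * sin (z - x).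
Proof.
rewrite [in row3 k (cos (x *+ 2))](mulr_cos2Dsin2 k x).
rewrite [in row3 k (cos (y *+ 2))](mulr_cos2Dsin2 k y).
rewrite [in row3 k (cos (z *+ 2))](mulr_cos2Dsin2 k z).
by rewrite det3_row3 !mulr2n !(sinB, sinD, cosD); ring.
Qed.

Lemma det3_mirror_tangents (R : realType) (k m x y : R) :
  det3 (row3 0 (sin m) (- cos m))
       (row3 k (cos (x *+ 2)) (sin (x *+ 2)))
       (row3 k (cos (y *+ 2)) (sin (y *+ 2))) =
  - 2 * k * sin (x - y) * sin (x + y - m).
Proof.
rewrite [in row3 k (cos (x *+ 2))](mulr_cos2Dsin2 k x).
rewrite [in row3 k (cos (y *+ 2))](mulr_cos2Dsin2 k y).
by rewrite det3_row3 !mulr2n !(sinB, sinD, cosD); ring.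
Qed.

Lemma det3_mirrors (R : realType) (k m p x y : R) :
  det3 (row3 0 (sin m) (- cos m)) (row3 0 (sin p) (- cos p)) (row3 k x y) =
  k * sin (p - m).
Proof. by rewrite det3_row3 sinB; ring. Qed.

(** * The real arrangement modulo q *)

Section RegularPolygon.
Variables (R : realType) (q : nat).
Hypotheses (q_prime : prime q) (q_odd : odd q).

Let t : R := pi / q%:R.
Let w (a : nat) : R := a%:R * t + t / 2.

Let q_gt2 : (2 < q)%N.
Proof. by case: q q_prime q_odd => [|[|[|]]]. Qed.

Let q_neq0 : q%:R != 0 :> R.
Proof. by rewrite pnatr_eq0; case: q q_gt2. Qed.

Let qt : q%:R * t = pi.
Proof. by rewrite /t mulrC divfK. Qed.

Let t_gt0 : 0 < t.
Proof. by rewrite divr_gt0 ?pi_gt0 // lt0r q_neq0 /=. Qed.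

(** A shift by [q%:R * t = pi] only changes the sign of the sine, so [k] may be
    reduced modulo [q], where the angle lies in [0, pi) and the sine vanishes
    only at 0. *)
Lemma sin_mul_eq0 (k : nat) : (sin (k%:R * t) == 0) = (q %| k)%N.
Proof.
have sin_small r : (0 < r < q)%N -> 0 < sin (r%:R * t).
  move=> /andP[r0 rq]; apply: sin_gt0_pi.
  by rewrite mulr_gt0 ?ltr0n //= -qt ltr_pM2r // ltr_nat.
rewrite [in LHS](divn_eq k q) /dvdn.
have := ltn_pmod k (ltnW (ltnW q_gt2)).
move: (k %% q)%N (k %/ q)%N => r d rq.
elim: d => [|d IHd].
  rewrite mul0n add0n; have [->|r0] := posnP r; first by rewrite mul0r sin0 !eqxx.
  by rewrite gt_eqF ?sin_small ?r0 // gtn_eqF.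
rewrite mulSn -addnA natrD mulrDl qt addrC sinDpi oppr_eq0.
exact: IHd.
Qed.

Lemma sin_subr_eq0 (a b : nat) :
  (sin (a%:R * t - b%:R * t) == 0) = (a%:R - b%:R == 0 :> 'F_q).
Proof.
wlog le_ba : a b / (b <= a)%N => [th|].
  have [/th//|/ltnW/th] := leqP b a.
  by rewrite -opprB sinN oppr_eq0 => ->; rewrite -oppr_eq0 opprB.
rewrite -mulrBl -!natrB // sin_mul_eq0.
by rewrite (dvdn_pcharf (pchar_Fp q_prime)).
Qed.

Lemma sin_t_neq0 : sin t != 0.
Proof.
by have := sin_mul_eq0 1; rewrite mul1r dvdn1 => ->; rewrite gtn_eqF // ltnW.
Qed.

(** This is where [q = 2], for which [2 * t = pi], has to be excluded: as [q]
    does not divide 2, already [sin (2 * t)] is nonzero. *)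
Lemma cos_t_neq0 : cos t != 0.
Proof.
have : sin (2%:R * t) != 0 by rewrite sin_mul_eq0 gtnNdvd.
by rewrite mulr_natl sin_mulr2n; apply: contra_neq => ->; rewrite mul0r mul0rn.
Qed.

(** The vertices bounding a side are at angles [w a *+ 2 - t] and
    [w a *+ 2 + t], so the side is the tangent at angle [w a *+ 2] to the
    circle of radius [cos t]. *)
Lemma alphaE (a : nat) :
  alpha R q a = (2 * sin t) *: row3 (- cos t) (cos (w a *+ 2)) (sin (w a *+ 2)).
Proof.
have cE m : c_ R q m = cos (m%:R * t).
  by rewrite /c_ /t; congr cos; field.
have sE m : s_ R q m = sin (m%:R * t).
  by rewrite /s_ /t; congr sin; field.
have at1 : (2 * a)%:R * t = w a *+ 2 - t by rewrite /w natrM; field.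
have at2 : (2 * a + 2)%:R * t = w a *+ 2 + t by rewrite /w natrD natrM; field.
rewrite /alpha !cE !sE at1 at2 row3Z.
move: (w a *+ 2) => y; rewrite !(sinB, cosB, sinD, cosD).
congr row3; try ring.
have cos2y : cos y ^+ 2 = 1 - sin y ^+ 2 by rewrite -(cos2Dsin2 y) addrK.
by ring: cos2y.
Qed.

Lemma alpha'E (m : nat) :
  alpha' R q m = row3 0 (sin (m%:R * t)) (- cos (m%:R * t)).
Proof.
by rewrite /alpha' /s_ /c_ /t; congr (row3 _ (sin _) (- cos _)); field.
Qed.

Lemma sin_subw_eq0 (a b : nat) :
  (sin (w a - w b) == 0) = (a%:R - b%:R == 0 :> 'F_q).
Proof. by rewrite -sin_subr_eq0; congr (sin _ == 0); rewrite /w; ring. Qed.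

Lemma det3_alpha (a b c : nat) :
  (det3 (alpha R q a) (alpha R q b) (alpha R q c) == 0) =
  ((a%:R - b%:R) * (b%:R - c%:R) * (c%:R - a%:R) == 0 :> 'F_q).
Proof.
rewrite !alphaE det3Z det3_tangents !mulf_eq0 oppr_eq0 !sin_subw_eq0 !pnatr_eq0 /=.
by rewrite !(negPf sin_t_neq0) (negPf cos_t_neq0).
Qed.

Lemma det3_alpha'_alpha2 (m a b : nat) :
  (det3 (alpha' R q m) (alpha R q a) (alpha R q b) == 0) =
  ((a%:R - b%:R) * (a%:R + b%:R + 1 - m%:R) == 0 :> 'F_q).
Proof.
have sinm : (sin (w a + w b - m%:R * t) == 0) =
    (a%:R + b%:R + 1 - m%:R == 0 :> 'F_q).
  rewrite -!natrD natr1 -sin_subr_eq0; congr (sin _ == 0).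
  by rewrite /w; field.
rewrite alpha'E !alphaE -[row3 0 _ _]scale1r det3Z det3_mirror_tangents.
rewrite !mulf_eq0 !oppr_eq0 sin_subw_eq0 sinm !pnatr_eq0 oner_eq0 /=.
by rewrite !(negPf sin_t_neq0) (negPf cos_t_neq0).
Qed.

Lemma det3_alpha'2_alpha (m p a : nat) :
  (det3 (alpha' R q m) (alpha' R q p) (alpha R q a) == 0) =
  (p%:R - m%:R == 0 :> 'F_q).
Proof.
rewrite !alpha'E alphaE -[row3 0 (sin (m%:R * t)) _]scale1r.
rewrite -[row3 0 (sin (p%:R * t)) _]scale1r det3Z det3_mirrors.
rewrite !mulf_eq0 oppr_eq0 sin_subr_eq0 !pnatr_eq0 oner_eq0 /=.
by rewrite !(negPf sin_t_neq0) (negPf cos_t_neq0).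
Qed.

End RegularPolygon.

Theorem theorem4p3 (R : realType) (q : nat) (q_prime : prime q)
  (q_odd : odd q) :
  isomorphic_incidences (Dempty q) (arrA R q).
Proof.
pose N (i : 'F_q + 'F_q) := match i with
  | inl c => row3 0 1 c
  | inr a => row3 1 a (a ^+ 2)
  end.
pose M (i : 'F_q + 'F_q) := match i with
  | inl c => alpha' R q (c + 1)%R
  | inr a => alpha R q a
  end.
(* Elements of 'F_q serve as natural number indices below q in [M]. *)
have FqK (x : 'F_q) : (x : nat)%:R = x by rewrite natr_Zp.
have Fq_lt (x : 'F_q) : (x < q)%N by rewrite -{2}(Fp_cast q_prime).
have ltFq m : (m < q)%N -> (m%:R : 'F_q) = m :> nat.
  by move=> mq; rewrite val_Fp_nat ?modn_small.
have -> : Dempty q = range (fun i => perp (N i)).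
  apply/seteqP; split => [_ [] [a _ <-] | _ [[c|a] _ <-]].
  - by exists (inl a).
  - by exists (inr a).
  - by left; exists c.
  - by right; exists a.
have -> : arrA R q = range (fun i => perp (M i)).
  apply/seteqP; split => [_ [] [m /= mq <-] | _ [[c|a] _ <-]].
  - by exists (inr m%:R) => //=; rewrite ltFq.
  - by exists (inl (m%:R - 1)) => //; rewrite /M subrK ltFq.
  - by right; exists (c + 1)%R => //; exact: Fq_lt.
  - by left; exists a => //; exact: Fq_lt.
apply: isomorphic_incidences_det3.
- by case=> [c|a]; [exists (inr 0) | exists (inl 0)].
- case=> [c|a] [d|b] neq.
  + exists (inr 0); rewrite det3_line2 subr_eq0.
    by apply/eqP => dc; apply: neq; rewrite dc.
  + exists (inl (c + 1)); rewrite -det3_eq0_swap23 det3_line2.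
    by rewrite addrAC subrr add0r oner_eq0.
  + exists (inl (d + 1)); rewrite -det3_eq0_swap12 -det3_eq0_swap23 det3_line2.
    by rewrite addrAC subrr add0r oner_eq0.
  + exists (inl (a + b + 1)).
    rewrite -det3_eq0_swap23 -det3_eq0_swap12 det3_line_conic.
    rewrite opprD addrA subrr add0r mulrN1 oppr_eq0 subr_eq0.
    by apply/eqP => ab; apply: neq; rewrite ab.
- have lines c d e : (det3 (N (inl c)) (N (inl d)) (N (inl e)) == 0) =
      (det3 (M (inl c)) (M (inl d)) (M (inl e)) == 0).
    by rewrite /N /M !alpha'E // !det3_col0 !eqxx.
  have lines2 c d a : (det3 (N (inl c)) (N (inl d)) (N (inr a)) == 0) =
      (det3 (M (inl c)) (M (inl d)) (M (inr a)) == 0).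
    rewrite /N /M det3_line2 det3_alpha'2_alpha // !FqK.
    by congr (_ == 0); ring.
  have line c a b : (det3 (N (inl c)) (N (inr a)) (N (inr b)) == 0) =
      (det3 (M (inl c)) (M (inr a)) (M (inr b)) == 0).
    rewrite /N /M det3_line_conic det3_alpha'_alpha2 // !FqK.
    by congr (_ == 0); ring.
  have conic a b c : (det3 (N (inr a)) (N (inr b)) (N (inr c)) == 0) =
      (det3 (M (inr a)) (M (inr b)) (M (inr c)) == 0).
    by rewrite /N /M det3_conic det3_alpha // !FqK.
  (* Swapping rows puts the normals with first coordinate 0 in front. *)
  case=> [c|a] [d|b] [e|f].
  + exact: lines.
  + exact: lines2.
  + by rewrite -[LHS]det3_eq0_swap23 -[RHS]det3_eq0_swap23.
  + exact: line.
  + rewrite -[LHS]det3_eq0_swap12 -[RHS]det3_eq0_swap12.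
    by rewrite -[LHS]det3_eq0_swap23 -[RHS]det3_eq0_swap23.
  + by rewrite -[LHS]det3_eq0_swap12 -[RHS]det3_eq0_swap12.
  + rewrite -[LHS]det3_eq0_swap23 -[RHS]det3_eq0_swap23.
    by rewrite -[LHS]det3_eq0_swap12 -[RHS]det3_eq0_swap12.
  + exact: conic.
Qed.
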